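(* Let $G$ be a finite connected simple graph without isolated vertices. Suppose that the clique complex $\Delta(G)$ is closed, and let $F_1,\dots,F_r$ be the leaf order of $\Delta(G)$ (the order on its facets with respect to which it is a closed linear quasi-tree). For $1\le i\le j\le r$ let $F_{i,j}=F_i\cap F_j$ (so $F_{i,i}=F_i$), and set $F_{i,j}=\emptyset$ if $i<1$ or $j>r$. For $i\in[r]$ let $n_i=\max\{j : i\le j\le r,\ F_{i,j}\ne\emptyset\}$, put $n_0=1$, and let $$\mathcal B=\{F_{1,1},\dots,F_{1,n_1},F_{2,n_1},\dots,F_{2,n_2},\dots,F_{r,r}\}=\{F_{i,j} : 1\le i\le r,\ n_{i-1}\le j\le n_i\},$$ regarded as indexed by the pairs $(i,j)$. For $F_{i,j}\in\mathcal B$ put $F'_{i,j}=F_{i,j}\setminus(F_{i-1,j}\cup F_{i,j+1})$. Then: (1) The family $\mathcal F=\{F'_{i,j}\}_{F_{i,j}\in\mathcal B}$ is a partition of $V(G)$, i.e. its members (some of which may be empty) are pairwise disjoint and their union is $V(G)$. (2) $G$ is closed with respect to any total order on the vertices of the following form: for the vertices in each $F'_{i,j}$ fix an arbitrary total order, and set $u<v$ if $u\in F'_{i,j}$ and $v\in F'_{k,\ell}$ with $i<k$, or with $i=k$ and $j<\ell$.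
   Context: The clique complex $\Delta(G)$ is the simplicial complex on $V(G)$ whose faces are the cliques of $G$; its facets are the maximal cliques. The subcomplex $\langle F_i,\dots,F_q\rangle$ is the simplicial complex with facets $F_i,\dots,F_q$. Leaf and branch: a facet $F$ of a simplicial complex $\Delta$ is a leaf of $\Delta$ if either $F$ is the only facet of $\Delta$, or there is a facet $B\ne F$ of $\Delta$, called a branch of $F$, such that $H\cap F\subseteq B\cap F$ for all facets $H\neq F$ of $\Delta$. Linear quasi-tree: a simplicial complex $\Delta$ is a linear quasi-tree if there is an ordering $F_1,\dots,F_q$ of its (distinct) facets such that (1) $F_i$ is a leaf of the subcomplex $\langle F_i,\dots,F_q\rangle$ for all $i$; and (2) for all $i<q$, $F_{i+1}$ is the only branch of $F_i$ in $\langle F_i,\dots,F_q\rangle$. Such an ordering is called the leaf order, and one writes $\Delta=\langle F_1,\dots,F_q\rangle$ with the facets in this order. Closed complex: a linear quasi-tree $\Delta=\langle F_1,\dots,F_r\rangle$ is closed if, with $F_{i,j}=F_i\cap F_j$ for $1\le i\le j\le r$ and $F_{i,j}=\emptyset$ if $i<1$ or $j>r$: (I) for all $1\le i\le j\le r$ and $1\le k\le\ell\le r$ with $i<k$ and $j<\ell$, the sets $F_{i,j}$ and $F_{k,\ell}$ are not comparable under inclusion, or at least one of them is empty; (C) for all $i\in[r]$ and $d\ge1$ with $F_{i,i+d+1}\neq\emptyset$, one has $F_{i+1,i+d}=F_{i,i+d}\cup F_{i+1,i+d+1}$. Closed graph: $G$ is closed with respect to a total order $<$ on $V(G)$ if for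 any two distinct edges $\{u,v\},\{u,w\}\in E(G)$ with either $u<v$ and $u<w$, or $u>v$ and $u>w$, one has $\{v,w\}\in E(G)$. *)

(* Defs.v *)
From mathcomp Require Import all_boot.

Set Implicit Arguments.
Unset Strict Implicit.
Unset Printing Implicit Defensive.

Section Complexes.
Variable T : finType.
Implicit Types (D : {set {set T}}) (F B A : {set T}) (s : seq {set T}).

(* A simplicial complex on T is represented by its set of faces. *)

Definition clique (e : rel T) A : bool :=
  [forall x in A, forall y in A, (x != y) ==> e x y].

Definition clique_complex (e : rel T) : {set {set T}} :=
  [set A | clique e A].

Definition facets D : {set {set T}} :=
  [set F | maxset (fun A => A \in D) F].

Definition generated_complex s : {set {set T}} :=
  [set A : {set T} | has (fun F : {set T} => A \subset F) s].

Definition branch D F B : Prop :=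
  [/\ B \in facets D, B != F &
      forall H, H \in facets D -> H != F -> H :&: F \subset B :&: F].

Definition leaf D F : Prop :=
  F \in facets D /\ (facets D = [set F] \/ exists B, branch D F B).

(* Facets are numbered from 1, as F_1, ..., F_r with r = size s; the value is *)
(* the empty set at index 0 and at every index greater than r.                *)
Definition facet_nth s (i : nat) : {set T} := nth set0 (set0 :: s) i.

(* <F_i, ..., F_r>, for 1 <= i <= r *)
Definition tail_complex s (i : nat) : {set {set T}} :=
  generated_complex (drop i.-1 s).

(* s is a leaf order exhibiting D as a linear quasi-tree. *)
Definition leaf_order D s : Prop :=
  [/\ uniq s,
      s =i facets D,
      forall i, 1 <= i <= size s -> leaf (tail_complex s i) (facet_nth s i) &
      forall i, 1 <= i < size s -> forall B,
        branch (tail_complex s i) (facet_nth s i) B <-> B = facet_nth s i.+1].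

(* F_{i,j}: by the convention on facet_nth it is empty if i < 1 or j > r. *)
Definition facetI s (i j : nat) : {set T} := facet_nth s i :&: facet_nth s j.

Definition intersections_incomparable s : Prop :=
  forall i j k l,
    1 <= i <= j -> j <= size s -> 1 <= k <= l -> l <= size s ->
    i < k -> j < l ->
    (~~ (facetI s i j \subset facetI s k l) /\
     ~~ (facetI s k l \subset facetI s i j)) \/
    (facetI s i j = set0 \/ facetI s k l = set0).

Definition intersections_cover s : Prop :=
  forall i d, 1 <= i <= size s -> 1 <= d ->
    facetI s i (i + d + 1) != set0 ->
    facetI s (i + 1) (i + d) =
      facetI s i (i + d) :|: facetI s (i + 1) (i + d + 1).

(* D is closed, with leaf order s. *)
Definition closed_leaf_order D s : Prop :=
  [/\ leaf_order D s, intersections_incomparable s & intersections_cover s].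

(* n_i, with n_0 = 1 *)
Definition last_meet s (i : nat) : nat :=
  if i == 0 then 1
  else \max_(i <= j < (size s).+1 | facetI s i j != set0) j.

(* The pairs (i, j) that index the family B. *)
Definition block_indices s : seq (nat * nat) :=
  [seq (i, j) | i <- index_iota 1 (size s).+1,
                j <- index_iota (last_meet s i.-1) (last_meet s i).+1].

(* F'_{i,j}, for p = (i, j) *)
Definition block s (p : nat * nat) : {set T} :=
  facetI s p.1 p.2 :\: (facetI s p.1.-1 p.2 :|: facetI s p.1 p.2.+1).

Definition strict_total_order_on A (lt : rel T) : Prop :=
  [/\ {in A, irreflexive lt},
      {in A & &, transitive lt} &
      {in A &, forall x y, x != y -> lt x y || lt y x}].

Definition index_lt (p q : nat * nat) : bool :=
  (p.1 < q.1) || (p.1 == q.1) && (p.2 < q.2).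

(* The relation on vertices that compares different blocks lexicographically  *)
(* by index and the elements of the block of index p by o p.                  *)
Definition block_lt s (o : nat * nat -> rel T) : rel T := fun u v =>
  has (fun p => has (fun q =>
    [&& u \in block s p, v \in block s q &
        index_lt p q || (p == q) && o p u v])
    (block_indices s)) (block_indices s).

Definition closed_graph_wrt (e lt : rel T) : Prop :=
  strict_total_order_on [set: T] lt /\
  forall u v w, e u v -> e u w -> v != w ->
    lt u v && lt u w || lt v u && lt w u -> e v w.

End Complexes.

(* Main.v *)
Require Import Defs.
From mathcomp Require Import all_boot.
From mathcomp Require Import zify.

(* The leaf order makes the facets containing a vertex v an interval          *)
(* F_a, ..., F_b, so v lies in F'_{i,j} exactly when (i, j) = (a, b).         *)
(* Condition (C) prevents one such interval from exceeding another at both    *)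
(* ends: a < a' implies b <= b'. Hence (a, b) satisfies                       *)
(* n_{a-1} <= b <= n_a and so indexes a member of the family, and both        *)
(* endpoints are nondecreasing along the order. Two vertices are adjacent     *)
(* exactly when their intervals meet, which reduces closedness of the graph   *)
(* to comparing endpoints.                                                    *)

Set Implicit Arguments.
Unset Strict Implicit.
Unset Printing Implicit Defensive.

Section ClosedComplexes.
Variable T : finType.
Implicit Types (D : {set {set T}}) (s : seq {set T}) (e : rel T) (u v x y : T).

Lemma clique_sub_facet e (A : {set T}) :
  clique e A -> exists2 F, F \in facets (clique_complex e) & A \subset F.
Proof.
move=> cA; have /maxset_exists[F maxF sAF] : A \in clique_complex e.
  by rewrite inE.
by exists F; rewrite // inE.
Qed.

Lemma facet_clique e (F : {set T}) :
  F \in facets (clique_complex e) -> clique e F.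
Proof. by rewrite inE => /maxsetp; rewrite inE. Qed.

Lemma facets_sub_eq D (F G : {set T}) :
  F \in facets D -> G \in facets D -> F \subset G -> G = F.
Proof. by rewrite !inE => /maxsetP[_ maxF] /maxsetp; apply: maxF. Qed.

Lemma facet_nth_default s k : ~~ (0 < k <= size s) -> facet_nth s k = set0.
Proof. by case: k => [|k] //= k_big; rewrite /facet_nth /= nth_default //; lia. Qed.

Lemma mem_facet_nth s k : 0 < k <= size s -> facet_nth s k \in s.
Proof. by case: k => [|k] //= k_le; apply: mem_nth. Qed.

Lemma facet_nth_mem s (F : {set T}) :
  F \in s -> exists2 k, 0 < k <= size s & facet_nth s k = F.
Proof.
move=> Fs; exists (index F s).+1; first by rewrite /= index_mem.
by rewrite /facet_nth /= nth_index.
Qed.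

(** Facets of [D] are pairwise incomparable, so each remains maximal among the faces below a sublist
    of them. *)
Lemma facet_nth_tail_facet D s i j :
  s =i facets D -> 0 < i <= j -> j <= size s ->
  facet_nth s j \in facets (tail_complex s i).
Proof.
move=> sE /andP[i_gt0 le_ij] le_js.
have Fj_s : facet_nth s j \in s by apply: mem_facet_nth; lia.
rewrite inE; apply/maxsetP; split.
  rewrite inE; apply/hasP; exists (facet_nth s j) => //.
  have -> : facet_nth s j = nth set0 (drop i.-1 s) (j - i).
    rewrite nth_drop; case: j le_ij le_js {Fj_s} => [|j] *; first by lia.
    by rewrite /facet_nth /=; congr nth; lia.
  by apply: mem_nth; rewrite size_drop /=; lia.
move=> A; rewrite inE => /hasP[G /mem_drop Gs sAG] sFA.
have eqG : G = facet_nth s j.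
  by apply: (@facets_sub_eq D); rewrite -?sE // (subset_trans sFA).
by apply/eqP; rewrite eqEsubset sFA andbT -eqG.
Qed.

(** Induction on [k], starting at [i]: since F_{k+1} is a branch of F_k in the tail complex, F_j ∩
    F_k lies in F_{k+1} for every j > k, so containment in F_k passes on to F_{k+1}. *)
Lemma leaf_order_convex D s i j k : leaf_order D s ->
  i <= k <= j -> facetI s i j \subset facet_nth s k.
Proof.
case=> s_uniq sE _ s_branch /andP[le_ik le_kj].
(* Outside the range 1..r the default facet is empty, and so is the intersection. *)
have [j_le|j_big] := leqP j (size s); last first.
  by rewrite /facetI (@facet_nth_default s j) ?setI0 ?sub0set //; lia.
case: i le_ik => [|i] le_ik.
  by rewrite /facetI (@facet_nth_default s 0) ?set0I ?sub0set.
elim: k le_ik le_kj => [|k IHk] // le_ik le_kj.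
have [-> |ne_ik] := eqVneq i k; first exact: subsetIl.
have le_i1k : i.+1 <= k by lia.
have sk := IHk le_i1k (ltnW le_kj).
have k_rng : 1 <= k < size s by lia.
have [_ _ /(_ (facet_nth s j)) brk] := (s_branch k k_rng _).2 erefl.
have Fj_tail : facet_nth s j \in facets (tail_complex s k).
  by apply: (@facet_nth_tail_facet D) => //; lia.
have ne_F : facet_nth s j != facet_nth s k.
  case: k j k_rng j_le le_kj {le_ik ne_ik le_i1k IHk sk Fj_tail brk}
    => [|k] // [|j] // *.
  by rewrite /facet_nth /= nth_uniq //=; lia.
have {brk Fj_tail ne_F} := subset_trans (brk Fj_tail ne_F) (subsetIl _ _).
by apply: subset_trans; rewrite subsetI subsetIr.
Qed.

Definition vertex_span s v (p : nat * nat) : Prop :=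
  [/\ 1 <= p.1 <= p.2, p.2 <= size s &
      forall k, (v \in facet_nth s k) = (p.1 <= k <= p.2)].

(** The clique {v} lies in some facet; the least and greatest indices of such facets are the
    endpoints, and convexity fills the gap. *)
Lemma vertex_span_exists e s v :
  leaf_order (clique_complex e) s -> exists p, vertex_span s v p.
Proof.
move=> s_lo; have [_ sE _ _] := s_lo.
have exP : exists k, v \in facet_nth s k.
  have /clique_sub_facet[F] : clique e [set v].
    apply/forall_inP => x /set1P->; apply/forall_inP => y /set1P->.
    by rewrite eqxx.
  rewrite -sE sub1set => /facet_nth_mem[k _ <-] vk; by exists k.
have bP k : v \in facet_nth s k -> 0 < k <= size s.
  by apply: contraTT => /facet_nth_default->; rewrite inE.
have leP k : v \in facet_nth s k -> k <= size s by move/bP; lia.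
case: (ex_minnP exP) => a va min_a.
case: (ex_maxnP exP leP) => b vb max_b.
exists (a, b); split=> /=; [have := bP _ va; have := min_a _ vb; lia|exact: leP|].
move=> k; apply/idP/idP => [vk|k_ab]; first by rewrite min_a // max_b.
have /subsetP := leaf_order_convex s_lo k_ab.
by apply; rewrite inE va.
Qed.

Lemma mem_facetI_span s v p i j : vertex_span s v p ->
  (v \in facetI s i j) = (p.1 <= i <= p.2) && (p.1 <= j <= p.2).
Proof. by case=> _ _ vE; rewrite inE !vE. Qed.

(** Removing F_{i-1,j} forces i to be the left endpoint of the span, and removing F_{i,j+1} forces j
    to be the right one. *)
Lemma mem_block_span s v p q : vertex_span s v p -> (v \in block s q) = (q == p).
Proof.
move=> vp; have [p1 p2 _] := vp.
case: p q p1 p2 vp => [a b] [i j] /= p1 p2 vp.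
by rewrite in_setD in_setU !(mem_facetI_span _ _ vp) /= xpair_eqE; lia.
Qed.

(** Suppose the span [a', b'] of [v] lay strictly inside that of [u] at both ends. Then [u] is in
    F_{a'-1,b'+1}, so (C) with i = a'-1 and d = b'-a'+1 puts [v] in F_{a'-1,b'} or F_{a',b'+1},
    contradicting its span. *)
Lemma span_last_mono s u v p q : intersections_cover s ->
  vertex_span s u p -> vertex_span s v q -> p.1 < q.1 -> p.2 <= q.2.
Proof.
move=> s_cov up vq lt_pq; rewrite leqNgt; apply/negP => lt_qp.
have [p1 p2 _] := up; have [q1 q2 _] := vq.
have i_rng : 1 <= q.1.-1 <= size s by lia.
have d_gt0 : 1 <= q.2 - q.1.-1 by lia.
have /(s_cov _ _ i_rng d_gt0) : facetI s q.1.-1 (q.1.-1 + (q.2 - q.1.-1) + 1) != set0.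
  by apply/set0Pn; exists u; rewrite (mem_facetI_span _ _ up); lia.
by move/setP/(_ v); rewrite in_setU !(mem_facetI_span _ _ vq); lia.
Qed.

(** With p = (a, b), [v] itself witnesses b <= n_a. For n_{a-1} <= b, any vertex of F_{a-1,j} has a
    span starting before a, hence ending by b, so j <= b. *)
Lemma span_mem_block_indices e s v p : leaf_order (clique_complex e) s ->
  intersections_cover s -> vertex_span s v p -> p \in block_indices s.
Proof.
move=> s_lo s_cov vp; have [p1 p2 _] := vp.
apply/allpairsPdep; exists p.1, p.2; rewrite -surjective_pairing.
split=> //; first by rewrite mem_index_iota; lia.
rewrite mem_index_iota ltnS /last_meet; apply/andP; split; last first.
  case: eqP => [|_]; first by lia.
  apply: (@leq_bigmax_seq _ _ (fun j => facetI s p.1 j != set0) id).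
    by rewrite mem_index_iota; lia.
  by apply/set0Pn; exists v; rewrite (mem_facetI_span _ _ vp); lia.
(* When [p.1 = 1] the lower bound is the convention n_0 = 1. *)
case: eqP => [|p1_gt1]; first by lia.
apply/bigmax_leqP_seq => j _ /set0Pn[u].
have [q uq] := vertex_span_exists u s_lo.
rewrite (mem_facetI_span _ _ uq) => u_mem.
by have := span_last_mono s_cov uq vp; lia.
Qed.

(** An edge lies in a facet, whose index is common to both spans. Conversely, spans that meet share
    the larger left endpoint, and the facet there is a clique. *)
Lemma edge_span e s u v p q : symmetric e -> irreflexive e ->
  leaf_order (clique_complex e) s -> vertex_span s u p -> vertex_span s v q ->
  e u v = [&& u != v, p.1 <= q.2 & q.1 <= p.2].
Proof.
move=> e_sym e_irr [_ sE _ _] [p1 p2 uE] [q1 q2 vE].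
apply/idP/and3P => [euv|[ne_uv le_pq le_qp]].
  have ne_uv : u != v by apply: contraTneq euv => ->; rewrite e_irr.
  have /clique_sub_facet[F] : clique e [set u; v].
    apply/forall_inP => x /set2P[]->; apply/forall_inP => y /set2P[]->;
    by rewrite ?eqxx ?euv ?implybT // e_sym euv implybT.
  rewrite -sE => /facet_nth_mem[k _ <-]; rewrite subUset !sub1set uE vE.
  by move=> uvk; split=> //; lia.
have /facet_clique : facet_nth s (maxn p.1 q.1) \in facets (clique_complex e).
  by rewrite -sE mem_facet_nth //; lia.
move=> /forall_inP/(_ u); rewrite uE => /(_ _)/forall_inP-/(_ _ v).
by rewrite vE ne_uv /=; apply; lia.
Qed.

Lemma block_lt_span s (o : nat * nat -> rel T) u v p q :
  p \in block_indices s -> q \in block_indices s ->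
  vertex_span s u p -> vertex_span s v q ->
  block_lt s o u v = index_lt p q || (p == q) && o p u v.
Proof.
move=> pI qI up vq; apply/hasP/idP => [[p' _ /hasP[q' _]]|lt_uv].
  by rewrite (mem_block_span _ up) (mem_block_span _ vq) => /and3P[/eqP-> /eqP->].
exists p => //; apply/hasP; exists q => //.
by rewrite (mem_block_span _ up) (mem_block_span _ vq) !eqxx.
Qed.

End ClosedComplexes.

Lemma index_lt_trans p q r : index_lt p q -> index_lt q r -> index_lt p r.
Proof. by rewrite /index_lt; lia. Qed.

Lemma index_lt_irr p : index_lt p p = false.
Proof. by rewrite /index_lt; lia. Qed.

Lemma index_lt_total p q : p != q -> index_lt p q || index_lt q p.
Proof. by case: p q => [a b] [c d]; rewrite /index_lt xpair_eqE /=; lia. Qed.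

Theorem theorem4p5 (T : finType) (e : rel T)
    (e_sym : symmetric e) (e_irr : irreflexive e)
    (e_conn : forall x y : T, connect e x y)
    (e_noiso : forall x : T, exists y : T, e x y)
    (s : seq {set T}) (s_closed : closed_leaf_order (clique_complex e) s) :
  ((forall p q : nat * nat, p \in block_indices s -> q \in block_indices s ->
      p != q -> [disjoint block s p & block s q]) /\
   \bigcup_(p <- block_indices s) block s p = [set: T]) /\
  (forall o : nat * nat -> rel T,
     (forall p : nat * nat, p \in block_indices s ->
        strict_total_order_on (block s p) (o p)) ->
     closed_graph_wrt e (block_lt s o)).
Proof.
have [s_lo _ s_cov] := s_closed.
have [f fP] := fin_all_exists (fun v => vertex_span_exists v s_lo).
have fI v : f v \in block_indices s := span_mem_block_indices s_lo s_cov (fP v).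
have inB v p : (v \in block s p) = (p == f v) := mem_block_span p (fP v).
split; first split.
- move=> p q _ _ ne_pq; apply/pred0P => v /=; rewrite !inB.
  by apply: contraNF ne_pq => /andP[/eqP-> /eqP->].
- by apply/setP => v; rewrite (big_rem (f v)) ?fI //= in_setU inB eqxx inE.
move=> o oP.
have ltE u v : block_lt s o u v =
    index_lt (f u) (f v) || (f u == f v) && o (f u) u v.
  exact: block_lt_span (fI u) (fI v) (fP u) (fP v).
(* The lexicographic order controls the right endpoints only when the left ones agree; otherwise
   [span_last_mono] does. *)
have span_mono u v : block_lt s o u v ->
    (f u).1 <= (f v).1 /\ (f u).2 <= (f v).2.
  rewrite ltE => /orP[|/andP[/eqP-> _]] //; rewrite /index_lt.
  by move=> lt_uv; have := span_last_mono s_cov (fP u) (fP v); lia.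
split; first split.
- move=> v _; have [irr _ _] := oP _ (fI v).
  by rewrite ltE index_lt_irr irr ?andbF // inB.
- move=> v u w _ _ _; rewrite !ltE.
  case/orP=> [lt_uv|/andP[/eqP fuv ouv]].
    case/orP=> [/(index_lt_trans lt_uv)-> //|/andP[/eqP<- _]].
    by rewrite lt_uv.
  case/orP=> [|/andP[/eqP fvw ovw]]; first by rewrite fuv => ->.
  have [_ tr _] := oP _ (fI v).
  by rewrite fuv in ouv *; rewrite -fvw eqxx (tr v) ?orbT // inB ?fuv ?fvw.
- move=> u v _ _ ne_uv; rewrite !ltE; have [fuv|ne_f] := eqVneq (f u) (f v).
    have [_ _ tot] := oP _ (fI u).
    by rewrite -fuv index_lt_irr /= tot // inB ?fuv.
  by case/orP: (index_lt_total ne_f) => ->; rewrite ?orbT.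
move=> u v w; rewrite !(edge_span e_sym e_irr s_lo (fP _) (fP _)).
move=> /and3P[_ uv1 uv2] /and3P[_ uw1 uw2] -> /=.
(* The spans of [v] and [w] share an endpoint of the span of [u]: the right one if both vertices
   come after [u], the left one if both come before. *)
by case/orP=> /andP[/span_mono[v1 v2] /span_mono[w1 w2]]; lia.
Qed.
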